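(* Let $G_N,G$ be proposal fields on the position space with values in $\mathbb R^d$, with each $G_N$ measurable and $G_N\to G$ locally uniformly as $N\to\infty$, and let $v:\mathbb R^d\to\mathbb R^d$. Assume that $G$ and $v$ are continuous. Fix $h>0$, $L\in\mathbb N$, and an admissible compact set $C$ (as defined in the context). Then $$\sup_{z\in C}\bigl|\Phi_{N,h}^L(z)-\Phi_h^L(z)\bigr|\longrightarrow0\qquad(N\to\infty),$$ and hence $$\sup_{z\in C}\bigl|\Psi_N(z)-\Psi(z)\bigr|\longrightarrow0\qquad(N\to\infty).$$
   Context: The position space is $\mathbb R^d$, or the positive orthant $(0,\infty)^d$ if the position variable is restricted to it; the phase space is position space times momentum space $\mathbb R^d$, with points $z=(x,p)$. Locally uniform convergence means uniform convergence on compact subsets of the position space. Define $$\mathcal P_{N,h}(x,p)=(x,p-hG_N(x)),\quad\mathcal P_h(x,p)=(x,p-hG(x)),\quad\mathcal Q_h(x,p)=(x+hv(p),p),\quad\mathcal R(x,p)=(x,-p),$$ $$\Phi_{N,h}=\mathcal P_{N,h/2}\circ\mathcal Q_h\circ\mathcal P_{N,h/2},\quad\Phi_h=\mathcal P_{h/2}\circ\mathcal Q_h\circ\mathcal P_{h/2},\quad\Psi_N=\mathcal R\circ\Phi_{N,h}^L,\quad\Psi=\mathcal R\circ\Phi_h^L,$$ where the superscript denotes iterated composition. Admissible compact set: for fixed $h>0$ and $L\in\mathbb N$, a compact subset $C$ of the phase space is admissible (for $\{\Phi_{N,h}\}_{N\ge0}$ and $\Phi_h$) if there exist a compact set $C_\ast$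 in $\mathbb R^d\times\mathbb R^d$ and an integer $N_0$ such that for every $N\ge N_0$ and every $\ell=0,\dots,L-1$, $$\Phi_{N,h}^\ell(C)\subset C_\ast,\quad\mathcal P_{N,h/2}(\Phi_{N,h}^\ell(C))\subset C_\ast,\quad\mathcal Q_h\circ\mathcal P_{N,h/2}(\Phi_{N,h}^\ell(C))\subset C_\ast,$$ $$\Phi_h^\ell(C)\subset C_\ast,\quad\mathcal P_{h/2}(\Phi_h^\ell(C))\subset C_\ast,\quad\mathcal Q_h\circ\mathcal P_{h/2}(\Phi_h^\ell(C))\subset C_\ast,$$ and moreover $\Phi_{N,h}^L(C)\cup\Phi_h^L(C)\subset C_\ast$ for all $N\ge N_0$, and $\mathcal R(C_\ast)=C_\ast$. If the position variable is restricted to the positive orthant, it is additionally required that the position projection of $C_\ast$ be compactly contained in that orthant. (In that case the trajectories from $C$ are well defined for $N\ge N_0$ and for the limiting maps by these containments.) *)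

(* Defs.v *)
From HB Require Import structures.
From mathcomp Require Import all_boot all_order all_algebra.
From mathcomp Require Import all_classical all_reals all_analysis.
Set Implicit Arguments.
Unset Strict Implicit.
Unset Printing Implicit Defensive.
Import Order.TTheory GRing.Theory Num.Theory.
Import numFieldNormedType.Exports.
Local Open Scope classical_set_scope.
Local Open Scope ring_scope.

Inductive position_domain := FullSpace | PositiveOrthant.

Definition position_space (R : realType) (d : nat) (D : position_domain)
    : set 'rV[R]_d :=
  match D with
  | FullSpace => setT
  | PositiveOrthant => [set x | forall i, 0 < x ord0 i]
  end.

Definition phase_space (R : realType) (d : nat) (D : position_domain)
    : set ('rV[R]_d * 'rV[R]_d) :=
  position_space D `*` setT.

Definition borel_rV (R : realType) (d : nat) :=
  g_sigma_algebraType (@open 'rV[R]_d).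

(* Fields on the position space are total functions whose values outside
   [position_space D] are arbitrary: every hypothesis below is relative to
   [position_space D], and admissibility confines all evaluations to it. *)

Definition kick (R : realType) (d : nat) (h : R) (G : 'rV[R]_d -> 'rV[R]_d)
    (z : 'rV[R]_d * 'rV[R]_d) : 'rV[R]_d * 'rV[R]_d :=
  (z.1, z.2 - h *: G z.1).

Definition drift (R : realType) (d : nat) (h : R) (v : 'rV[R]_d -> 'rV[R]_d)
    (z : 'rV[R]_d * 'rV[R]_d) : 'rV[R]_d * 'rV[R]_d :=
  (z.1 + h *: v z.2, z.2).

Definition flip (R : realType) (d : nat)
    (z : 'rV[R]_d * 'rV[R]_d) : 'rV[R]_d * 'rV[R]_d :=
  (z.1, - z.2).

Definition Phi (R : realType) (d : nat) (h : R) (G v : 'rV[R]_d -> 'rV[R]_d)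
    : 'rV[R]_d * 'rV[R]_d -> 'rV[R]_d * 'rV[R]_d :=
  kick (h / 2) G \o drift h v \o kick (h / 2) G.

Definition Psi (R : realType) (d : nat) (h : R) (L : nat)
    (G v : 'rV[R]_d -> 'rV[R]_d)
    : 'rV[R]_d * 'rV[R]_d -> 'rV[R]_d * 'rV[R]_d :=
  @flip R d \o iter L (Phi h G v).

Definition compactly_contained (T : topologicalType) (A B : set T) :=
  compact (closure A) /\ closure A `<=` B.

Definition trajectories_in (R : realType) (d : nat) (h : R) (L : nat)
    (G v : 'rV[R]_d -> 'rV[R]_d) (C K : set ('rV[R]_d * 'rV[R]_d)) :=
  (forall l, (l < L)%N ->
    [/\ iter l (Phi h G v) @` C `<=` K,
        kick (h / 2) G @` (iter l (Phi h G v) @` C) `<=` K &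
        (drift h v \o kick (h / 2) G) @` (iter l (Phi h G v) @` C) `<=` K]) /\
  iter L (Phi h G v) @` C `<=` K.

Definition admissible (R : realType) (d : nat) (D : position_domain)
    (h : R) (L : nat) (GN : nat -> 'rV[R]_d -> 'rV[R]_d)
    (G v : 'rV[R]_d -> 'rV[R]_d) (C : set ('rV[R]_d * 'rV[R]_d)) :=
  [/\ compact C, C `<=` phase_space D &
    exists (Cstar : set ('rV[R]_d * 'rV[R]_d)) (N0 : nat),
      [/\ compact Cstar,
          forall N, (N0 <= N)%N -> trajectories_in h L (GN N) v C Cstar,
          trajectories_in h L G v C Cstar,
          @flip R d @` Cstar = Cstar &
          D = PositiveOrthant ->
            compactly_contained (fst @` Cstar) (position_space D)]].

(* The library norms on row vectors and on products are maximum norms. *)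
Definition euclidean_norm (R : realType) (d : nat)
    (z : 'rV[R]_d * 'rV[R]_d) : R :=
  Num.sqrt (\sum_i z.1 ord0 i ^+ 2 + \sum_i z.2 ord0 i ^+ 2).

(* The supremum is taken in [0, +oo]: it is +oo for an unbounded difference,
   and inserting 0 makes it 0, rather than -oo, when C is empty. *)
Definition sup_dist (R : realType) (d : nat) (C : set ('rV[R]_d * 'rV[R]_d))
    (f g : 'rV[R]_d * 'rV[R]_d -> 'rV[R]_d * 'rV[R]_d) : \bar R :=
  ereal_sup (0%E |` [set (euclidean_norm (f z - g z))%:E | z in C]).

(* Main.v *)
Require Import Defs.
From HB Require Import structures.
From mathcomp Require Import all_boot all_order all_algebra.
From mathcomp Require Import all_classical all_reals all_analysis.
Set Implicit Arguments.
Unset Strict Implicit.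
Unset Printing Implicit Defensive.
Import Order.TTheory GRing.Theory Num.Theory.
Import numFieldNormedType.Exports.
Local Open Scope classical_set_scope.
Local Open Scope ring_scope.

(** The one analytic fact behind the theorem is that uniform convergence passes
    through composition with a varying outer map ([uniform_cvg_comp]): if
    [f_i -> f] uniformly on A, the values of [f] and, eventually, of the [f_i]
    stay in a compact set K, [g_i -> g] uniformly on K and [g] is continuous on
    K, then [g_i \o f_i -> g \o f] uniformly on A, because
      [|g_i (f_i x) - g (f x)| <=
         |g_i (f_i x) - g (f_i x)| + |g (f_i x) - g (f x)|],
    where the first term is small by uniform convergence on K and the second by
    uniform continuity of [g] on K.

    A leapfrog step is a kick, a drift and a kick. A kick evaluates the field at
    the current position and a drift evaluates the velocity at the current
    momentum; the other operations in them are linear. Hence each of the three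
    maps preserves uniform convergence on C of the trajectories
    ([kick_uniform_cvg], [drift_uniform_cvg]), the compact sets being the
    position and momentum projections of the set that confines the trajectories.
    The position projection lies in the position space, which is where the
    fields converge locally uniformly to a continuous limit. Induction on the
    number of steps gives uniform convergence of the L-th iterates
    ([iter_Phi_uniform_cvg]). The momentum flip is an isometry, so the claim for
    [Psi] is literally the same supremum ([sup_dist_flip]). *)

(** * Uniform convergence along a filter *)

Lemma uniform_cvg_ballP (R : numFieldType) (T : choiceType)
    (V : pseudoMetricType R) (I : Type) (F : set_system I) (A : set T)
    (fn : I -> T -> V) (f : T -> V) : Filter F ->
  {uniform A, fn @ F --> f} <->
  forall e : R, 0 < e ->
    \forall i \near F, forall x, A x -> ball (f x) e (fn i x).
Proof.
move=> FF; split=> [cvf e e0|cvf P /uniform_nbhs[E [entE EP]]].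
  suff /cvf : nbhs (f : {uniform` A -> V})
    [set g | forall x, A x -> ball (f x) e (g x)] by [].
  apply/uniform_nbhs; exists [set xy | ball xy.1 e xy.2]; split => //.
  exact: entourage_ball (PosNum e0).
move: entE; rewrite -entourage_ballE => -[e /= e0 eE].
apply: filterS (cvf e e0) => i fnf; apply: EP => x Ax.
exact/eE/fnf.
Qed.

Lemma uniform_cvg_cst (R : numFieldType) (T : choiceType)
    (V : pseudoMetricType R) (I : Type) (F : set_system I) (A : set T)
    (f : T -> V) : Filter F -> {uniform A, (fun=> f) @ F --> f}.
Proof.
move=> FF; apply/uniform_cvg_ballP => e e0.
by apply: filterE => i x _; exact: ballxx.
Qed.

(** Heine's theorem on K is built into the proof: the estimate of
    [g (f_i x) - g (f x)] is proved near each point [y] of K for [f x] close to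
    [y], and compactness makes the index threshold uniform in [y]. *)
Lemma uniform_cvg_comp (R : numFieldType) (T : choiceType)
    (U V : pseudoMetricType R) (I : Type) (F : set_system I) (A : set T)
    (K : set U) (fn : I -> T -> U) (f : T -> U)
    (gn : I -> U -> V) (g : U -> V) :
  Filter F -> compact K -> {within K, continuous g} ->
  (\forall i \near F, fn i @` A `<=` K) -> f @` A `<=` K ->
  {uniform A, fn @ F --> f} -> {uniform K, gn @ F --> g} ->
  {uniform A, (fun i => gn i \o fn i) @ F --> g \o f}.
Proof.
move=> FF cK cg fnK fK /uniform_cvg_ballP cvf /uniform_cvg_ballP cvg.
apply/uniform_cvg_ballP => e e0.
have e20 : 0 < e / 2 by rewrite divr_gt0.
have gng := cvg _ e20.
have unif : \forall i \near F, forall y, K y ->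
    forall x, A x -> f x = y -> ball (g y) (e / 2) (g (fn i x)).
  move/compact_near_coveringP/near_covering_withinP: cK; apply => y Ky.
  move/subspace_continuousP : cg => /(_ y Ky)/cvg_ballP/(_ (e / 2 / 2)).
  move=> /(_ ltac:(by rewrite divr_gt0)).
  rewrite /= near_withinE => /nbhs_ballP[r /= r0 rg].
  have r20 : 0 < r / 2 by rewrite divr_gt0.
  exists (ball y (r / 2), [set i | fn i @` A `<=` K /\
      forall x, A x -> ball (f x) (r / 2) (fn i x)]).
    split; first exact: nbhsx_ballx.
    by apply: filterI => //; exact: cvf.
  move=> [y' i] /= [yy' [fniK fni]] Ky' x Ax fxy'.
  apply: (@ball_splitr _ _ (g y)).
    apply: rg => //; apply: le_ball yy'.
    by rewrite ler_pdivrMr// mulr_natr mulr2n lerDl ltW.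
  apply: rg; last by apply: fniK; exists x.
  by apply: ball_split yy' _; rewrite -fxy'; exact: fni.
near=> i => x Ax /=; apply: (@ball_split _ _ (g (fn i x))).
  by apply: (near unif i _ (f x)) => //; apply: fK; exists x.
by apply: (near gng i) => //; apply: (near fnK i) => //; exists x.
Unshelve. all: end_near. Qed.

Lemma uniform_cvg_fst (R : numFieldType) (T : choiceType) (I : Type)
    (F : set_system I) (U V : pseudoMetricType R) (A : set T)
    (fn : I -> T -> U * V) f :
  Filter F -> {uniform A, fn @ F --> f} ->
  {uniform A, (fun i => fst \o fn i) @ F --> fst \o f}.
Proof.
move=> FF /uniform_cvg_ballP fnf; apply/uniform_cvg_ballP => e e0.
by apply: filterS (fnf e e0) => i fni x /fni[].
Qed.

Lemma uniform_cvg_snd (R : numFieldType) (T : choiceType) (I : Type)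
    (F : set_system I) (U V : pseudoMetricType R) (A : set T)
    (fn : I -> T -> U * V) f :
  Filter F -> {uniform A, fn @ F --> f} ->
  {uniform A, (fun i => snd \o fn i) @ F --> snd \o f}.
Proof.
move=> FF /uniform_cvg_ballP fnf; apply/uniform_cvg_ballP => e e0.
by apply: filterS (fnf e e0) => i fni x /fni[].
Qed.

Lemma uniform_cvg_pair (R : numFieldType) (T : choiceType) (I : Type)
    (F : set_system I) (U V : pseudoMetricType R) (A : set T)
    (fn : I -> T -> U) f (gn : I -> T -> V) g :
  Filter F -> {uniform A, fn @ F --> f} -> {uniform A, gn @ F --> g} ->
  {uniform A, (fun i x => (fn i x, gn i x)) @ F --> (fun x => (f x, g x))}.
Proof.
move=> FF /uniform_cvg_ballP fnf /uniform_cvg_ballP gng.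
apply/uniform_cvg_ballP => e e0.
apply: filterS2 (fnf e e0) (gng e e0) => i fni gni x Ax.
by split; [exact: fni|exact: gni].
Qed.

Lemma uniform_cvg_addZ (R : numFieldType) (T : choiceType) (I : Type)
    (F : set_system I) (V : normedModType R) (A : set T)
    (fn gn : I -> T -> V) f g (a : R) :
  Filter F -> {uniform A, fn @ F --> f} -> {uniform A, gn @ F --> g} ->
  {uniform A, (fun i x => fn i x + a *: gn i x) @ F -->
    (fun x => f x + a *: g x)}.
Proof.
move=> FF /uniform_cvg_ballP fnf /uniform_cvg_ballP gng.
apply/uniform_cvg_ballP => e e0.
have e20 : 0 < e / 2 by rewrite divr_gt0.
have a0 : 0 < `|a| + 1 by rewrite ltr_wpDl.
(* Dividing by [`|a| + 1] avoids the case [a = 0]. *)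
have ea0 : 0 < e / 2 / (`|a| + 1) by rewrite divr_gt0.
apply: filterS2 (fnf _ e20) (gng _ ea0) => i fni gni x Ax.
have := fni x Ax; have := gni x Ax; rewrite -!ball_normE /= => gx fx.
rewrite opprD addrACA -scalerBr (splitr e) (le_lt_trans (ler_normD _ _))//.
rewrite ltrD// normrZ.
rewrite (@le_lt_trans _ _ ((`|a| + 1) * `|g x - gn i x|))//.
  by rewrite ler_wpM2r// lerDl.
by rewrite mulrC -ltr_pdivlMr.
Qed.

Lemma compact_fst (U V : topologicalType) (K : set (U * V)) :
  compact K -> compact (fst @` K).
Proof.
apply: continuous_compact; apply: continuous_subspaceT => z.
exact: cvg_fst.
Qed.

Lemma compact_snd (U V : topologicalType) (K : set (U * V)) :
  compact K -> compact (snd @` K).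
Proof.
apply: continuous_compact; apply: continuous_subspaceT => z.
exact: cvg_snd.
Qed.

(** * One leapfrog step and its iterates *)

Lemma kick_uniform_cvg (R : realType) (d : nat) (T : choiceType) (I : Type)
    (F : set_system I) (A : set T) (X : set 'rV[R]_d) (a : R)
    (Gn : I -> 'rV[R]_d -> 'rV[R]_d) (G : 'rV[R]_d -> 'rV[R]_d)
    (zn : I -> T -> 'rV[R]_d * 'rV[R]_d) z :
  Filter F -> compact X -> {within X, continuous G} ->
  {uniform X, Gn @ F --> G} ->
  (\forall i \near F, (fst \o zn i) @` A `<=` X) -> (fst \o z) @` A `<=` X ->
  {uniform A, zn @ F --> z} ->
  {uniform A, (fun i => kick a (Gn i) \o zn i) @ F --> kick a G \o z}.
Proof.
move=> FF cX cG GnG znX zX znz.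
have x_cvg := uniform_cvg_fst FF znz.
have -> : kick a G \o z =
    fun t => ((fst \o z) t, (snd \o z) t + (- a) *: (G \o (fst \o z)) t).
  by apply/funext => t; rewrite /kick /= scaleNr.
have -> : (fun i => kick a (Gn i) \o zn i) = fun i t => ((fst \o zn i) t,
    (snd \o zn i) t + (- a) *: (Gn i \o (fst \o zn i)) t).
  by apply/funext => i; apply/funext => t; rewrite /kick /= scaleNr.
have G_cvg := uniform_cvg_comp FF cX cG znX zX x_cvg GnG.
have p_cvg := uniform_cvg_addZ (a := - a) FF (uniform_cvg_snd FF znz) G_cvg.
exact: uniform_cvg_pair FF x_cvg p_cvg.
Qed.

Lemma drift_uniform_cvg (R : realType) (d : nat) (T : choiceType) (I : Type)
    (F : set_system I) (A : set T) (P : set 'rV[R]_d) (a : R)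
    (v : 'rV[R]_d -> 'rV[R]_d) (zn : I -> T -> 'rV[R]_d * 'rV[R]_d) z :
  Filter F -> compact P -> {within P, continuous v} ->
  (\forall i \near F, (snd \o zn i) @` A `<=` P) -> (snd \o z) @` A `<=` P ->
  {uniform A, zn @ F --> z} ->
  {uniform A, (fun i => drift a v \o zn i) @ F --> drift a v \o z}.
Proof.
move=> FF cP cv znP zP znz.
have p_cvg := uniform_cvg_snd FF znz.
have v_cvg := uniform_cvg_comp FF cP cv znP zP p_cvg
  (uniform_cvg_cst (f := v) FF).
have x_cvg := uniform_cvg_addZ (a := a) FF (uniform_cvg_fst FF znz) v_cvg.
exact: uniform_cvg_pair FF x_cvg p_cvg.
Qed.

(** A step applies three maps, and the three containments required of a
    confined trajectory are exactly what the convergence of each of them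
    consumes: the iterate for the first kick, its image under that kick for the
    drift, and the drifted point for the second kick. *)
Lemma iter_Phi_uniform_cvg (R : realType) (d : nat) (h : R) (L : nat)
    (GN : nat -> 'rV[R]_d -> 'rV[R]_d) (G v : 'rV[R]_d -> 'rV[R]_d)
    (C K : set ('rV[R]_d * 'rV[R]_d)) (N0 : nat) :
  compact K -> {within fst @` K, continuous G} ->
  {uniform fst @` K, GN @ \oo --> G} -> continuous v ->
  (forall N, (N0 <= N)%N -> trajectories_in h L (GN N) v C K) ->
  trajectories_in h L G v C K ->
  {uniform C, (fun N => iter L (Phi h (GN N) v)) @ \oo --> iter L (Phi h G v)}.
Proof.
move=> cK cG GNG cv trajN [traj _].
have cX := compact_fst cK.
have cP := compact_snd cK.
suff : forall l, (l <= L)%N ->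
  {uniform C, (fun N => iter l (Phi h (GN N) v)) @ \oo --> iter l (Phi h G v)}.
  by apply.
elim=> [_|l IHl lL]; first exact: (uniform_cvg_cst (f := id)).
have {}IHl := IHl (ltnW lL).
have {traj} [z0K z1K z2K] := traj l lL.
have trajNl : \forall N \near \oo,
    [/\ iter l (Phi h (GN N) v) @` C `<=` K,
        kick (h / 2) (GN N) @` (iter l (Phi h (GN N) v) @` C) `<=` K &
        (drift h v \o kick (h / 2) (GN N)) @`
          (iter l (Phi h (GN N) v) @` C) `<=` K].
  by exists N0 => // N /= /trajN[/(_ l lL)].
apply: (@kick_uniform_cvg _ _ _ _ _ _ (fst @` K) _ GN G
  (fun N => drift h v \o kick (h / 2) (GN N) \o iter l (Phi h (GN N) v))
  (drift h v \o kick (h / 2) G \o iter l (Phi h G v))) => //.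
- apply: filterS trajNl => N [_ _ KN] _ [z Cz <-].
  by apply: imageP; apply: KN; apply: imageP; exact: imageP.
- move=> _ [z Cz <-]; apply: imageP.
  by apply: z2K; apply: imageP; exact: imageP.
apply: (@drift_uniform_cvg _ _ _ _ _ _ (snd @` K) _ v
  (fun N => kick (h / 2) (GN N) \o iter l (Phi h (GN N) v))
  (kick (h / 2) G \o iter l (Phi h G v))) => //.
- exact: continuous_subspaceT.
- apply: filterS trajNl => N [_ KN _] _ [z Cz <-].
  by apply: imageP; apply: KN; apply: imageP; exact: imageP.
- move=> _ [z Cz <-]; apply: imageP.
  by apply: z1K; apply: imageP; exact: imageP.
apply: (@kick_uniform_cvg _ _ _ _ _ _ (fst @` K)) => //.
- apply: filterS trajNl => N [KN _ _] _ [z Cz <-].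
  by apply: imageP; apply: KN; exact: imageP.
- by move=> _ [z Cz <-]; apply: imageP; apply: z0K; exact: imageP.
Qed.

(** * The supremum of Euclidean distances *)

(** The uniform structure on phase space is coordinatewise; this bound
    turns closeness in it into closeness in the Euclidean norm, at the cost of a
    factor that depends only on the dimension. *)
Lemma euclidean_norm_le (R : realType) (d : nat) (z : 'rV[R]_d * 'rV[R]_d)
    (e : R) : 0 <= e ->
  (forall i, `|z.1 ord0 i| <= e) -> (forall i, `|z.2 ord0 i| <= e) ->
  euclidean_norm z <= Num.sqrt (d + d)%:R * e.
Proof.
move=> e0 z1e z2e.
have sum_le (x : 'rV[R]_d) : (forall i, `|x ord0 i| <= e) ->
    \sum_i x ord0 i ^+ 2 <= d%:R * e ^+ 2.
  move=> xe; rewrite mulr_natl -[in leRHS](card_ord d) -sumr_const.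
  apply: ler_sum => i _; rewrite -[leLHS]real_normK ?num_real//.
  by rewrite ler_pXn2r ?nnegrE.
rewrite -[e in leRHS]ger0_norm// -sqrtr_sqr -sqrtrM//.
rewrite ler_sqrt ?mulr_ge0 ?sqr_ge0//.
by rewrite natrD mulrDl lerD// sum_le.
Qed.

Lemma sup_dist_flip (R : realType) (d : nat) (C : set ('rV[R]_d * 'rV[R]_d))
    (f g : 'rV[R]_d * 'rV[R]_d -> 'rV[R]_d * 'rV[R]_d) :
  sup_dist C (@flip R d \o f) (@flip R d \o g) = sup_dist C f g.
Proof.
rewrite /sup_dist; congr (ereal_sup (_ `|` _)).
apply: eq_imagel => z _; rewrite /euclidean_norm /=.
congr (Num.sqrt (_ + _))%:E.
by apply: eq_bigr => i _; rewrite -opprD !mxE sqrrN.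
Qed.

Lemma cvg_sup_dist (R : realType) (d : nat) (I : Type) (F : set_system I)
    (C : set ('rV[R]_d * 'rV[R]_d))
    (fn : I -> 'rV[R]_d * 'rV[R]_d -> 'rV[R]_d * 'rV[R]_d) f :
  Filter F -> {uniform C, fn @ F --> f} ->
  sup_dist C (fn i) f @[i --> F] --> 0%E.
Proof.
move=> FF /uniform_cvg_ballP fnf.
have sup_ge0 i : (0 <= sup_dist C (fn i) f)%E.
  by apply: ereal_sup_ubound; left.
have sup_le (e : R) : 0 < e ->
    \forall i \near F, (sup_dist C (fn i) f <= e%:E)%E.
  move=> e0; pose c : R := Num.sqrt (d + d)%:R.
  (* Dividing by [c + 1] avoids the case [d = 0]. *)
  have c0 : 0 < c + 1 by rewrite ltr_wpDl// sqrtr_ge0.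
  have ec0 : 0 < e / (c + 1) by rewrite divr_gt0.
  apply: filterS (fnf _ ec0) => i fni.
  apply: ge_ereal_sup => _ [->|[z Cz <-]]; first by rewrite lee_fin ltW.
  (* Balls of row vectors unfold to coordinatewise balls. *)
  have [[_ z1] [_ z2]] := fni z Cz.
  rewrite lee_fin (le_trans (euclidean_norm_le (ltW ec0) _ _))//.
  - by move=> k; have := z1 ord0 k; rewrite -ball_normE /= !mxE distrC => /ltW.
  - by move=> k; have := z2 ord0 k; rewrite -ball_normE /= !mxE distrC => /ltW.
  by rewrite -/c mulrA ler_pdivrMr// mulrC ler_pM2l// lerDl.
apply/fine_cvgP; split.
  apply: filterS (sup_le 1 ltr01) => i /le_lt_trans sup1.
  by rewrite ge0_fin_numE// sup1// ltry.
apply/cvgr0Pnorm_le => e e0; apply: filterS (sup_le e e0) => i sup_lee.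
rewrite /= ger0_norm ?fine_ge0// -lee_fin fineK//.
by rewrite ge0_fin_numE// (le_lt_trans sup_lee)// ltry.
Qed.

(** * Convergence of the iterated integrators *)

Theorem theorem3p3 (R : realType) (d : nat) (D : position_domain)
  (GN : nat -> 'rV[R]_d -> 'rV[R]_d) (G v : 'rV[R]_d -> 'rV[R]_d)
  (mGN : forall N, measurable_fun (position_space D : set (borel_rV R d))
                     (GN N : borel_rV R d -> borel_rV R d))
  (GN_G : {family compactly_in (position_space D), GN @ \oo --> G})
  (cG : {within position_space D, continuous G})
  (cv : continuous v)
  (h : R) (h_gt0 : 0 < h) (L : nat)
  (C : set ('rV[R]_d * 'rV[R]_d))
  (admC : admissible D h L GN G v C) :
  (sup_dist C (iter L (Phi h (GN N) v)) (iter L (Phi h G v)) @[N --> \oo]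
     --> 0%E) /\
  (sup_dist C (Psi h L (GN N) v) (Psi h L G v) @[N --> \oo] --> 0%E).
Proof.
have [_ _ [K [N0 [cK trajN traj _ KD]]]] := admC.
(* The position projection of the compact set [K] is compact, so this inclusion
   makes it one of the sets on which the fields converge uniformly. *)
have KX : fst @` K `<=` position_space D.
  case: {cG GN_G mGN admC} D KD => // /(_ erefl)[_ KD].
  exact: subset_trans (@subset_closure _ _) KD.
have Phi_cvg : {uniform C, (fun N => iter L (Phi h (GN N) v)) @ \oo -->
    iter L (Phi h G v)}.
  apply: (iter_Phi_uniform_cvg cK) trajN traj => //.
    exact: continuous_subspaceW cG.
  by have /fam_cvgP := GN_G; apply; split => //; exact: compact_fst.
split; first exact: cvg_sup_dist.
rewrite (_ : (fun N => _) =
    fun N => sup_dist C (iter L (Phi h (GN N) v)) (iter L (Phi h G v))).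
  exact: cvg_sup_dist.
by apply/funext => N; exact: sup_dist_flip.
Qed.
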